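(* Let $s\ge 3$ be an integer. If $G$ is a finite, connected, $d$-regular simple graph with diameter at least $s$, then \[\min_{v,r}\delta(\mathcal{L}_r(v))\leq\left\lfloor \frac{sd}{2s-1}\right\rfloor-1,\] where the minimum is over all vertices $v$ of $G$ and all integers $r\ge 1$ with $\mathcal{S}_r(v)\neq\varnothing$.
   Context: For a graph $G$, a vertex $v$ and an integer $r>0$, the sphere $\mathcal{S}_r(v)=\{w\in V(G): d(v,w)=r\}$ is the set of vertices at graph distance exactly $r$ from $v$. If $\mathcal{S}_r(v)\neq\varnothing$, the $r$-link graph of $v$ is the induced subgraph $\mathcal{L}_r(v)=G[\mathcal{S}_r(v)]$. $\delta(H)$ denotes the minimum degree of a graph $H$. *)

(* Defs.v *)
From mathcomp Require Import all_boot all_order all_algebra.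
Set Implicit Arguments.
Unset Strict Implicit.
Unset Printing Implicit Defensive.

Record sgraph := SGraph {
  vertex :> finType;
  adj : rel vertex;
  adj_sym : symmetric adj;
  adj_irrefl : irreflexive adj
}.

Definition deg (G : sgraph) (v : G) : nat := #|[set w : G | adj v w]|.

Definition regular (d : nat) (G : sgraph) : Prop := forall v : G, deg v = d.

Definition connected (G : sgraph) : Prop := forall v w : G, connect (@adj G) v w.

(* The default #|G| exceeds every degree, so on a nonempty graph this is the
   true minimum (see min_degreeP). *)
Definition min_degree (G : sgraph) : nat := \big[minn/#|G|]_(v : G) deg v.

Lemma induced_sym (G : sgraph) (A : {set G}) :
  symmetric (fun x y : {x : G | x \in A} => adj (val x) (val y)).
Proof. by move=> x y; exact: adj_sym. Qed.

Lemma induced_irrefl (G : sgraph) (A : {set G}) :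
  irreflexive (fun x y : {x : G | x \in A} => adj (val x) (val y)).
Proof. by move=> x; exact: adj_irrefl. Qed.

Definition induced (G : sgraph) (A : {set G}) : sgraph :=
  SGraph (@induced_sym G A) (@induced_irrefl G A).

Definition walk (G : sgraph) (n : nat) (v w : G) : bool :=
  [exists p : n.-tuple G, path (@adj G) v p && (last v p == w)].

(* The least length of a walk from v to w; the value is the sentinel #|G| when
   w is not reachable from v (a finite distance is always < #|G|, see distP). *)
Definition dist (G : sgraph) (v w : G) : nat :=
  find (fun n => walk n v w) (iota 0 #|G|).

(* The connectivity guard discards the sentinel value of dist. *)
Definition sphere (G : sgraph) (r : nat) (v : G) : {set G} :=
  [set w | connect (@adj G) v w && (dist v w == r)].

Definition link (G : sgraph) (r : nat) (v : G) : sgraph :=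
  induced (sphere r v).

(* The usual diameter when G is connected. *)
Definition diameter (G : sgraph) : nat := \max_(v : G) \max_(w : G) dist v w.

Definition is_minimum (P : nat -> Prop) (m : nat) : Prop :=
  P m /\ forall k, P k -> m <= k.

Definition link_min_degree (G : sgraph) (k : nat) : Prop :=
  exists (v : G) (r : nat),
    [/\ 1 <= r, sphere r v != set0 & k = min_degree (link r v)].

Lemma min_degreeP (G : sgraph) :
  0 < #|G| -> is_minimum (fun k => exists v : G, k = deg v) (min_degree G).
Proof.
move=> G0; have lt v : deg (v : G) < #|G|.
  rewrite -cardsT; apply: proper_card; rewrite properT.
  by apply/eqP=> /setP/(_ v); rewrite !inE adj_irrefl.
have le : forall v : G, min_degree G <= deg v.
  move=> v; rewrite /min_degree; have := mem_index_enum v.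
  elim: (index_enum _) => // x r IH; rewrite inE big_cons.
  by case/orP=> [/eqP<- | /IH]; [exact: geq_minl | exact: leq_trans (geq_minr _ _)].
split; last by move=> k [v ->].
have [|[v ->]] // : min_degree G = #|G| \/ exists v : G, min_degree G = deg v; last by exists v.
- rewrite /min_degree; elim/big_ind: _ => [|x y Hx Hy|v _]; [by left| |by right; exists v].
  by rewrite /minn; case: ifP.
- case/card_gt0P: G0 => v _ E; have := leq_ltn_trans (le v) (lt v).
  by rewrite E ltnn.
Qed.

Lemma distP (G : sgraph) (v w : G) : connect (@adj G) v w ->
  [/\ dist v w < #|G|, walk (dist v w) v w
    & forall n, walk n v w -> dist v w <= n].
Proof.
case/connectP=> p0 /shortenP[p pP up _] ->; set u := last v p.
have H : has (fun n => walk n v u) (iota 0 #|G|).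
  apply/hasP; exists (size p).
    by rewrite mem_iota add0n leq0n /= (leq_trans _ (max_card (mem (v :: p)))) // (card_uniqP up).
  by apply/existsP; exists (in_tuple p); rewrite pP eqxx.
have L : dist v u < #|G| by move: H; rewrite has_find size_iota.
split=> //; first by have := nth_find 0 H; rewrite nth_iota.
move=> n Hn; rewrite leqNgt; apply/negP=> ln.
have := before_find 0 ln; rewrite nth_iota ?(ltn_trans ln L) //.
by rewrite add0n Hn.
Qed.

(* Main.v *)
Require Import Defs.
From mathcomp Require Import all_boot all_order all_algebra.
From mathcomp Require Import zify.
Set Implicit Arguments.
Unset Strict Implicit.
Unset Printing Implicit Defensive.

(** Let [k] be the least link degree, and fix a vertex [y].  A vertex [x] at
    distance [n + 1] from [y] has at least [k] neighbours in its own sphere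
    around [y], so its numbers [c x] and [b x] of neighbours one level down and
    one level up satisfy [c x + b x <= d - k].  If [x] is a neighbour of [w] one
    level above it, the links of radius 1 give at least [k] common neighbours
    of [w] and [x]; at most [b w - 1] of them lie on the level of [x] and the
    others on the level of [w], so [c x >= k + 2 - b w >= c w + (2 k + 2 - d)].
    Hence [c x >= 1 + n (2 k + 2 - d)] at distance [n + 1], and comparing with
    [c x <= d - k] gives [(2 r - 1) (k + 1) <= r d] at every positive distance
    [r] that occurs. *)

(** For [x] at distance [n + 1] from [y], the levels [n], [n + 1], [n + 2] give [c x], the degree of
    [x] in its link, and [b x]. *)
Definition nbr_at (G : sgraph) (y : G) (n : nat) (x : G) : {set G} :=
  [set w | adj x w && (dist y w == n)].

Lemma walkS (G : sgraph) (n : nat) (v w : G) :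
  walk n.+1 v w <-> exists2 u, walk n v u & adj u w.
Proof.
split.
- case/existsP=> -[s /= /eqP]; case/lastP: s => // s z; rewrite size_rcons.
  case=> sz; rewrite rcons_path last_rcons => /andP[/andP[ps zs] /eqP<-].
  exists (last v s) => //; apply/existsP.
  by exists (Tuple (introT eqP sz)); rewrite /= ps eqxx.
- case=> u /existsP[p /andP[pp /eqP pu]] uw; apply/existsP.
  by exists [tuple of rcons p w]; rewrite /= rcons_path last_rcons pp pu uw eqxx.
Qed.

Lemma dist_adj (G : sgraph) (v u w : G) :
  connected G -> adj u w -> dist v w <= (dist v u).+1.
Proof.
move=> hc uw; have [_ wu _] := distP (hc v u).
by have [_ _ ->] := distP (hc v w); last by apply/walkS; exists u.
Qed.

Lemma dist_eq0 (G : sgraph) (v w : G) :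
  connected G -> (dist v w == 0) = (v == w).
Proof.
move=> hc; have [_ ww wm] := distP (hc v w); apply/eqP/eqP => [E|<-].
  by move: ww; rewrite E => /existsP[p]; rewrite tuple0 => /andP[_ /eqP].
have [_ _ vm] := distP (hc v v); apply/eqP; rewrite -leqn0; apply: vm.
by apply/existsP; exists [tuple]; rewrite /= eqxx.
Qed.

Lemma dist_pred (G : sgraph) (v w : G) (n : nat) :
  connected G -> dist v w = n.+1 -> exists2 u, adj u w & dist v u = n.
Proof.
move=> hc E; have [_ ww _] := distP (hc v w).
move: ww; rewrite E => /walkS[u wu uw]; exists u => //.
have [_ _ /(_ _ wu) le] := distP (hc v u).
by have := dist_adj v hc uw; lia.
Qed.

Lemma dist_eq1 (G : sgraph) (v w : G) :
  connected G -> (dist v w == 1) = adj v w.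
Proof.
move=> hc; apply/eqP/idP => [/(dist_pred hc)[u uw] /eqP|vw].
  by rewrite dist_eq0 // => /eqP->.
apply/eqP; rewrite eqn_leq lt0n dist_eq0 //.
have /eqP v0 : dist v v == 0 by rewrite dist_eq0.
(* The bound 1 is read as [(dist v v).+1], so that [dist_adj] applies to the edge from [v] to
   [w]. *)
rewrite -{1}v0 dist_adj //=.
by apply: contraTneq vw => ->; rewrite adj_irrefl.
Qed.

Lemma card_nbr_at (G : sgraph) (y x : G) (n : nat) :
  #|nbr_at y n x| + #|nbr_at y n.+1 x| + #|nbr_at y n.+2 x| <= deg x.
Proof.
have dis (i j : nat) : i != j -> [disjoint nbr_at y i x & nbr_at y j x].
  move=> ij; rewrite -setI_eq0; apply/eqP/setP => w; rewrite !inE.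
  by apply/negbTE; apply: contra ij => /andP[/andP[_ /eqP<-] /andP[_ /eqP<-]].
have cardU (A B : {set G}) : [disjoint A & B] -> #|A| + #|B| = #|A :|: B|.
  by move=> AB; apply/esym/eqP; rewrite (leq_card_setU A B).
rewrite cardU; last by rewrite dis // ltn_eqF.
rewrite cardU; last first.
  by rewrite -setI_eq0 setIUl setU_eq0 !setI_eq0 !dis // ltn_eqF.
apply/subset_leq_card/subsetP => w.
by rewrite !inE -orbA => /or3P[] /andP[].
Qed.

Lemma deg_link (G : sgraph) (y x : G) (r : nat) (xS : x \in sphere r y) :
  connected G -> @deg (link r y) (exist _ x xS) = #|nbr_at y r x|.
Proof.
move=> hc; rewrite /deg -(card_imset _ val_inj); apply: eq_card => w.
rewrite !inE; apply/imsetP/andP => [[u]|[xw dw]].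
  by rewrite inE /= => xu ->; split=> //; have := valP u; rewrite inE => /andP[].
have wS : w \in sphere r y by rewrite inE hc.
by exists (exist _ w wS); rewrite ?inE.
Qed.

Lemma min_degree_link (G : sgraph) (y x : G) (r : nat) :
  connected G -> dist y x = r -> min_degree (link r y) <= #|nbr_at y r x|.
Proof.
move=> hc yx; have xS : x \in sphere r y by rewrite inE hc yx eqxx.
rewrite -(deg_link xS hc).
have [|_] := @min_degreeP (link r y).
  by apply/card_gt0P; exists (exist _ x xS).
by apply; exists (exist _ x xS).
Qed.

(** A nonempty sphere has radius below [#|G|], so the search over radii is finite and the predicate
    decidable, as [ex_minnP] requires. *)
Lemma link_min_degree_min (G : sgraph) (m : nat) :
  link_min_degree G m -> exists n, is_minimum (link_min_degree G) n.
Proof.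
pose P k := [exists v : G, [exists r : 'I_#|G|,
  [&& 0 < r, sphere r v != set0 & k == min_degree (link r v)]]].
have PP k : P k <-> link_min_degree G k.
  split.
    by case/existsP=> v /existsP[r /and3P[? ? /eqP ?]]; exists v, r.
  case=> v [r [r0 rS ->]]; apply/existsP; exists v.
  have [w] := set0Pn _ rS; rewrite inE => /andP[vw /eqP dw].
  have [lt _ _] := distP vw; rewrite dw in lt.
  by apply/existsP; exists (Ordinal lt); rewrite /= r0 rS eqxx.
move=> /PP Pm; have exP : exists k, P k by exists m.
by case: (ex_minnP exP) => n /PP Pn nm; exists n; split=> // k /PP /nm.
Qed.

Section LinkDegree.
Variables (G : sgraph) (d k : nat).
Hypotheses (hc : connected G) (hreg : regular d G).
Hypothesis hk :
  forall (y x : G) (r : nat), dist y x = r.+1 -> k <= #|nbr_at y r.+1 x|.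

Lemma card_down_step (y w x : G) (n : nat) :
  dist y w = n.+1 -> dist y x = n.+2 -> adj w x ->
  #|nbr_at y n w| + 2 * k.+1 <= #|nbr_at y n.+1 x| + d.
Proof.
move=> yw yx wx.
have xw : adj x w by rewrite adj_sym.
have /eqP wx1 : dist w x == 1 by rewrite dist_eq1.
have kc := hk wx1.
have ks := hk yw.
have := card_nbr_at y w n; rewrite hreg => tot.
(* A common neighbour is at most one level above [w] and at most one below [x], hence on one of
   their two levels. Deleting [w] and [x], which are not their own neighbours, turns [2 * k] into
   [2 * k.+1]. *)
have sub : nbr_at w 1 x \subset
    (nbr_at y n.+1 x :\ w) :|: (nbr_at y n.+2 w :\ x).
  apply/subsetP=> u; rewrite !inE dist_eq1 // => /andP[xu wu].
  have uNw : u != w by apply: contraTneq wu => ->; rewrite adj_irrefl.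
  have uNx : u != x by apply: contraTneq xu => ->; rewrite adj_irrefl.
  rewrite uNw uNx xu wu /=.
  have := dist_adj y hc wu; have := dist_adj y hc (etrans (adj_sym u x) xu).
  lia.
have := leq_trans (subset_leq_card sub) (leq_card_setU _ _).
have := cardsD1 w (nbr_at y n.+1 x); have := cardsD1 x (nbr_at y n.+2 w).
rewrite !inE xw wx yw yx !eqxx /=.
lia.
Qed.

(** The term [n * d] stays on the right because [2 k + 2 - d] may be negative. *)
Lemma card_down (y x : G) (n : nat) :
  dist y x = n.+1 -> (n * (2 * k.+1)).+1 <= #|nbr_at y n x| + n * d.
Proof.
elim: n x => [|n IH] x yx; have [w wx yw] := dist_pred hc yx.
  rewrite !mul0n addn0; apply/card_gt0P; exists w.
  by rewrite inE adj_sym wx yw eqxx.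
have := IH w yw; have := card_down_step yw yx wx; nia.
Qed.

Lemma link_degree_bound (y x : G) (n : nat) :
  dist y x = n.+1 -> n.*2.+1 * k.+1 <= n.+1 * d.
Proof.
move=> yx; have := card_down yx; have := hk yx.
(* Dropping [b x] from the degree count leaves [c x + k <= d]. *)
have := card_nbr_at y x n; rewrite hreg; nia.
Qed.

End LinkDegree.

Lemma diameter_witness (G : sgraph) (s : nat) :
  0 < s -> s <= diameter G -> exists v w : G, s <= dist v w.
Proof.
move=> s0 sd; case: (pickP [pred p : G * G | s <= dist p.1 p.2]).
  by case=> v w /= ?; exists v, w.
move=> no; suff: diameter G <= s.-1 by lia.
apply/bigmax_leqP => v _; apply/bigmax_leqP => w _.
by have := no (v, w); rewrite /=; lia.
Qed.

Theorem theorem2 (s d : nat) (G : sgraph) (hs : 3 <= s)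
  (hconn : connected G) (hreg : regular d G) (hdiam : s <= diameter G) :
  exists2 m : nat, is_minimum (link_min_degree G) m &
    (m%:Z <= (s * d %/ (2 * s - 1))%N%:Z - 1)%R.
Proof.
have [v [w svw]] := diameter_witness (ltnW (ltnW hs)) hdiam.
have Lk (y x : G) r :
    dist y x = r.+1 -> link_min_degree G (min_degree (link r.+1 y)).
  move=> yx; exists y, r.+1; split=> //; apply/set0Pn; exists x.
  by rewrite inE hconn yx eqxx.
have vw : dist v w = (dist v w).-1.+1 by lia.
have [m mmin] := @link_min_degree_min _ _ (Lk _ _ _ vw).
exists m => //; case: mmin => _ mmin.
(* Minimality makes [m] a lower bound for every degree in every link, so the section applies with
   [k := m]. *)
have hk (y x : G) r : dist y x = r.+1 -> m <= #|nbr_at y r.+1 x|.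
  move=> yx; apply: leq_trans (min_degree_link hconn yx).
  exact: mmin (Lk _ _ _ yx).
have bound := link_degree_bound hconn hreg hk vw.
(* The bound [r d >= (2 r - 1) (m + 1)] at [r = dist v w] only weakens when [r]
   decreases to [s]. *)
have : m.+1 <= s * d %/ (2 * s - 1).
  rewrite leq_divRL; last lia.
  move: bound svw; set r := dist v w; nia.
lia.
Qed.
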